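(* Let $\mathcal{C}$ be a prevariety over a finite alphabet $A$. Then $\mathit{SF}(\mathcal{C}) = \mathrm{LTL}(\mathcal{C}) = \mathrm{LTLP}(\mathcal{C})$.
   Context: Fix a finite alphabet $A$. A prevariety is a class of regular languages over $A$ containing $\emptyset$ and $A^*$, closed under union, intersection, complement, and under the quotients $u^{-1}L=\{w\mid uw\in L\}$ and $Lu^{-1}=\{w\mid wu\in L\}$. $\mathit{SF}(\mathcal{C})$ is the least class containing $\mathcal{C}$ and all $\{a\}$ ($a\in A$), closed under union, complement and concatenation. A word $w=a_1\cdots a_n$ has positions $\{0,\dots,n+1\}$, position $i\in\{1,\dots,n\}$ carrying label $a_i$, and $0$, $n+1$ unlabeled; for $i<j$, $w(i,j)=a_{i+1}\cdots a_{j-1}$. Formulas of $\mathrm{LTLP}[\mathcal{C}]$ are built from atomic formulas $\top$, $\mathit{min}$, $\mathit{max}$ and $a$ ($a\in A$) using $\vee,\wedge,\neg$ and, for each $L\in\mathcal{C}$, binary modalities $\psi_1\,\mathrm{U}_L\,\psi_2$ (until) and $\psi_1\,\mathrm{S}_L\,\psi_2$ (since). Semantics at a position $i$ of $w$: $\top$ always holds; $a$ holds iff $i$ is labeled $a$; $\mathit{min}$ holds iff $i=0$; $\mathit{max}$ holds iff $i=n+1$; Boolean connectives as usual; $w,i\models\psi_1\,\mathrm{U}_L\,\psi_2$ iff there is $j>i$ with $w(i,j)\in L$, $w,j\models\psi_2$ and $w,k\models\psi_1$ for all $i<k<j$; $w,i\models\psi_1\,\mathrm{S}_L\,\psi_2$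 iff there is $j<i$ with $w(j,i)\in L$, $w,j\models\psi_2$ and $w,k\models\psi_1$ for all $j<k<i$. A formula $\varphi$ defines the language $\{w\mid w,0\models\varphi\}$. $\mathrm{LTL}[\mathcal{C}]$ is the set of $\mathrm{LTLP}[\mathcal{C}]$ formulas without any since-modality. $\mathrm{LTL}(\mathcal{C})$ (resp. $\mathrm{LTLP}(\mathcal{C})$) is the class of languages defined by $\mathrm{LTL}[\mathcal{C}]$ (resp. $\mathrm{LTLP}[\mathcal{C}]$) formulas. *)

(* Defs.v *)
From mathcomp Require Import all_boot.
Set Implicit Arguments. Unset Strict Implicit. Unset Printing Implicit Defensive.

Section Lang.
Variable A : finType.

Definition lang := seq A -> Prop.

Definition regular (L : lang) : Prop :=
  exists (Q : finType) (q0 : Q) (d : Q -> A -> Q) (F : pred Q),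
    forall w, L w <-> F (foldl d q0 w).

(* A prevariety.  Classes of languages are sets of sets, so we also require
   the class to be closed under extensional equality of languages. *)
Definition prevariety (C : lang -> Prop) : Prop :=
  [/\ (forall L L', C L -> (forall w, L w <-> L' w) -> C L'),
      (forall L, C L -> regular L),
      C (fun _ => False) & C (fun _ => True)] /\
  [/\
      (forall L1 L2, C L1 -> C L2 -> C (fun w => L1 w \/ L2 w)),
      (forall L1 L2, C L1 -> C L2 -> C (fun w => L1 w /\ L2 w)),
      (forall L, C L -> C (fun w => ~ L w)),
      (forall L u, C L -> C (fun w => L (u ++ w))) &
      (forall L u, C L -> C (fun w => L (w ++ u)))].

Definition concat (L1 L2 : lang) : lang :=
  fun w => exists u v, w = u ++ v /\ L1 u /\ L2 v.

Inductive SF (C : lang -> Prop) : lang -> Prop :=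
| SF_base L : C L -> SF C L
| SF_letter a : SF C (fun w => w = [:: a])
| SF_union L1 L2 : SF C L1 -> SF C L2 -> SF C (fun w => L1 w \/ L2 w)
| SF_compl L : SF C L -> SF C (fun w => ~ L w)
| SF_concat L1 L2 : SF C L1 -> SF C L2 -> SF C (concat L1 L2)
| SF_ext L L' : SF C L -> (forall w, L w <-> L' w) -> SF C L'.

Inductive formula : Type :=
| FTop | FMin | FMax
| FLetter of A
| FOr of formula & formula
| FAnd of formula & formula
| FNot of formula
| FUntil of lang & formula & formula
| FSince of lang & formula & formula.

(* Infix w(i,j) = a_{i+1} ... a_{j-1}  (w = a_1 ... a_n, positions 0..n+1). *)
Definition infix_between (w : seq A) (i j : nat) : seq A :=
  drop i (take j.-1 w).

Fixpoint sat (w : seq A) (i : nat) (phi : formula) : Prop :=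
  match phi with
  | FTop => True
  | FMin => i = 0
  | FMax => i = (size w).+1
  | FLetter a => 0 < i /\ nth None (map Some w) i.-1 = Some a
  | FOr p q => sat w i p \/ sat w i q
  | FAnd p q => sat w i p /\ sat w i q
  | FNot p => ~ sat w i p
  | FUntil L p q =>
      exists j, [/\ i < j, j <= (size w).+1, L (infix_between w i j),
                    sat w j q & forall k, i < k < j -> sat w k p]
  | FSince L p q =>
      exists j, [/\ j < i, L (infix_between w j i),
                    sat w j q & forall k, j < k < i -> sat w k p]
  end.

Fixpoint over (C : lang -> Prop) (phi : formula) : Prop :=
  match phi with
  | FTop | FMin | FMax | FLetter _ => True
  | FOr p q | FAnd p q => over C p /\ over C q
  | FNot p => over C p
  | FUntil L p q | FSince L p q => [/\ C L, over C p & over C q]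
  end.

Fixpoint future_only (phi : formula) : Prop :=
  match phi with
  | FTop | FMin | FMax | FLetter _ => True
  | FOr p q | FAnd p q => future_only p /\ future_only q
  | FNot p => future_only p
  | FUntil _ p q => future_only p /\ future_only q
  | FSince _ _ _ => False
  end.

Definition defines (phi : formula) (L : lang) : Prop :=
  forall w, L w <-> sat w 0 phi.

Definition LTLP (C : lang -> Prop) (L : lang) : Prop :=
  exists phi, over C phi /\ defines phi L.

Definition LTL (C : lang -> Prop) (L : lang) : Prop :=
  exists phi, [/\ over C phi, future_only phi & defines phi L].

End Lang.

(* Main.v *)
Require Import Defs.
From mathcomp Require Import all_boot.
From mathcomp Require Import boolp.

(** The inclusion of [SF C] in [LTL C] is proved as in the local divisor
    technique of Diekert and Gastin, relatively to [C].  Every language of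
    [SF C] is recognized by a finite-index congruence [f] on words which is
    aperiodic over a congruence [h] whose classes are in [C]: if [h (w w) = h w]
    then [f (w^k) = f (w^(k+1))] for some [k].  The classes of such an [f] are
    definable by future formulas with modalities indexed by [h]-saturated
    languages, by induction on the index of [f] and on the alphabet.  If all
    letters are left invertible modulo [f], aperiodicity forces [f] to factor
    through [h].  Otherwise, let [c] be a letter which is not: the
    [c]-free blocks of a word are handled by induction on the alphabet, and the
    sequence of the classes of its blocks, seen as a word over a new alphabet,
    by induction on the index, since [ts |-> f (c t1 c ... c tn c)] never takes
    the value [f [::]].

    The inclusion of [LTLP C] in [SF C] holds because the truth of a formula at
    a position only depends on its label and on the classes of the words on its
    left and on its right, for some finite-index congruence with classes in
    [SF C]. *)

Set Implicit Arguments.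
Unset Strict Implicit.
Unset Printing Implicit Defensive.

(** * Boolean classes of languages and fibers of finite-valued maps *)

Section BooleanClasses.
Variable A : finType.
Implicit Types (K : lang A -> Prop) (L : lang A).

Definition boolean_class K : Prop :=
  [/\ forall L L', K L -> (forall w, L w <-> L' w) -> K L',
      K (fun _ => True),
      forall L, K L -> K (fun w => ~ L w) &
      forall L1 L2, K L1 -> K L2 -> K (fun w => L1 w \/ L2 w)].

Definition fibers_in K (T : Type) (f : seq A -> T) : Prop :=
  forall t, K (fun w => f w = t).

Variable K : lang A -> Prop.
Hypothesis bK : boolean_class K.

Lemma bool_ext L L' : K L -> (forall w, L w <-> L' w) -> K L'.
Proof. by case: bK => H _ _ _; apply: H. Qed.

Lemma bool_not L : K L -> K (fun w => ~ L w).
Proof. by case: bK => _ _ H _; apply: H. Qed.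

Lemma bool_or L1 L2 : K L1 -> K L2 -> K (fun w => L1 w \/ L2 w).
Proof. by case: bK => _ _ _ H; apply: H. Qed.

Lemma bool_and L1 L2 : K L1 -> K L2 -> K (fun w => L1 w /\ L2 w).
Proof.
move=> K1 K2.
apply: (bool_ext (bool_not (bool_or (bool_not K1) (bool_not K2)))) => w.
by rewrite not_orE !notK.
Qed.

Lemma bool_const (P : Prop) : K (fun _ => P).
Proof.
case: bK => ext KT KN _; have [p|np] := pselect P; first exact: (ext _ _ KT).
by apply: (ext _ _ (KN _ KT)) => w; split=> // nT; case: nT.
Qed.

Lemma bool_exists (I : finType) (F : I -> lang A) :
  (forall i, K (F i)) -> K (fun w => exists i, F i w).
Proof.
move=> KF.
have Ks (s : seq I) : K (fun w => exists2 i, i \in s & F i w).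
  elim: s => [|i s IH].
    by apply: (bool_ext (bool_const False)) => w; split=> // -[].
  apply: (bool_ext (bool_or (KF i) IH)) => w; split.
    case=> [Fi|[j js Fj]]; first by exists i; rewrite ?mem_head.
    by exists j; rewrite // inE js orbT.
  by case=> j; rewrite inE => /orP[/eqP->|js] Fj; [left|right; exists j].
apply: (bool_ext (Ks (enum I))) => w.
by split=> [[i _ Fi]|[i Fi]]; exists i; rewrite ?mem_enum.
Qed.

Lemma bool_forall (I : finType) (F : I -> lang A) :
  (forall i, K (F i)) -> K (fun w => forall i, F i w).
Proof.
move=> KF.
apply: (bool_ext (bool_not (bool_exists (fun i => bool_not (KF i))))) => w.
split=> [nF i|F_ [i]]; last by apply.
by apply: contrapT => nFi; apply: nF; exists i.
Qed.

Lemma bool_iff L1 L2 : K L1 -> K L2 -> K (fun w => L1 w <-> L2 w).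
Proof.
move=> K1 K2.
apply: (bool_ext (bool_or (bool_and K1 K2)
                          (bool_and (bool_not K1) (bool_not K2)))) => w.
by split=> [|[h1 h2]]; [tauto | have [|] := pselect (L1 w); tauto].
Qed.

(** [L] is the finite union of the fibers of [f] that meet it. *)
Lemma fibers_determine (T : finType) (f : seq A -> T) L :
  fibers_in K f -> (forall x y, f x = f y -> L x -> L y) -> K L.
Proof.
move=> Kf Lf.
apply: (bool_ext (bool_exists (fun t =>
  bool_and (Kf t) (bool_const (exists2 v, f v = t & L v))))) => w.
split=> [[t [ft [v fv Lv]]]|Lw]; first by apply: Lf Lv; rewrite fv.
by exists (f w); split=> //; exists w.
Qed.

Lemma fibers_pair (T T' : finType) (f : seq A -> T) (g : seq A -> T') :
  fibers_in K f -> fibers_in K g -> fibers_in K (fun w => (f w, g w)).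
Proof.
move=> Kf Kg [t t']; apply: (bool_ext (bool_and (Kf t) (Kg t'))) => w.
by split=> [[-> ->]|[-> ->]].
Qed.

Lemma fibers_set (I : finType) (F : seq A -> {set I}) :
  (forall i, K (fun w => i \in F w)) -> fibers_in K F.
Proof.
move=> KF S.
apply: (bool_ext (bool_forall (fun i =>
  bool_iff (KF i) (bool_const (i \in S))))) => w.
split=> [h|-> //]; apply/setP => i; apply/idP/idP; by move/h.
Qed.

End BooleanClasses.

(** * Congruences, powers, relative aperiodicity, and cuts of words *)

Section Congruences.
Variable A : finType.
Implicit Types (x y u v w : seq A).

Definition congruence (M : Type) (f : seq A -> M) : Prop :=
  forall x x' y y', f x = f x' -> f y = f y' -> f (x ++ y) = f (x' ++ y').

Definition wpow w k := flatten (nseq k w).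

Lemma wpowS w k : wpow w k.+1 = w ++ wpow w k.
Proof. by []. Qed.

Lemma wpowD w i j : wpow w (i + j) = wpow w i ++ wpow w j.
Proof. by rewrite /wpow nseqD flatten_cat. Qed.

Lemma wpowSr w k : wpow w k.+1 = wpow w k ++ w.
Proof. by rewrite -addn1 wpowD /wpow /= cats0. Qed.

Lemma all_wpow (B : pred A) w k : all B w -> all B (wpow w k).
Proof. by move=> Bw; elim: k => // k IH; rewrite wpowS all_cat Bw. Qed.

Lemma cat_eq_cat x y u v : x ++ y = u ++ v ->
  (exists z, u = x ++ z /\ y = z ++ v) \/ (exists z, x = u ++ z /\ v = z ++ y).
Proof.
elim: x u => [|a x IH] [|b u] /=.
- by move=> ->; left; exists [::].
- by move=> ->; left; exists (b :: u).
- by move=> <-; right; exists (a :: x).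
- by case=> -> /IH[[z [-> ->]]|[z [-> ->]]]; [left|right]; exists z.
Qed.

(** The cut falls in one copy of [w], namely [x' ++ y']; [i] and [j] count the whole copies on
    either side of it. *)
Lemma wpow_split w k x y : wpow w k.+1 = x ++ y ->
  exists i j x' y', [/\ k = i + j, w = x' ++ y', x = wpow w i ++ x'
                     & y = y' ++ wpow w j].
Proof.
elim: k x => [|k IH] x.
  by rewrite /wpow /= cats0 => ->; exists 0, 0, x, y; rewrite /wpow /= cats0.
rewrite wpowS => /cat_eq_cat[[z [-> /IH]]|[z [-> ->]]].
  case=> i [j [x' [y' [-> wE -> ->]]]]; exists i.+1, j, x', y'.
  by rewrite wpowS catA.
by exists 0, k.+1, x, z.
Qed.

Lemma wpow_join x y i j :
  wpow (x ++ y) (i + j).+1 = (wpow (x ++ y) i ++ x) ++ y ++ wpow (x ++ y) j.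
Proof. by rewrite -addnS wpowD wpowS -!catA. Qed.

Lemma congr_wpow_le (M : Type) (f : seq A -> M) w k n : congruence f ->
  f (wpow w k) = f (wpow w k.+1) -> k <= n -> f (wpow w n) = f (wpow w n.+1).
Proof.
move=> cf e /subnKC <-; rewrite -addSn !wpowD; exact: cf.
Qed.

(** By pigeonhole the powers of [w] are periodic under [f] from some exponent [i] on, with period
    [p]. Any positive multiple of [p] that is at least [i], such as [i.+1 * p], is an idempotent
    exponent. *)
Lemma congr_idempotent_power (M : finType) (f : seq A -> M) w : congruence f ->
  exists r, f (wpow w r.+1 ++ wpow w r.+1) = f (wpow w r.+1).
Proof.
move=> cf; pose g (i : 'I_#|M|.+1) := f (wpow w i).
have [/injectiveP inj|] := boolP (injectiveb g).
  by have := leq_card g inj; rewrite card_ord ltnn.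
case/injectivePn => i [j ij gij].
wlog lt_ij : i j ij gij / i < j.
  move=> H; have [|lt|e] := ltngtP i j; first exact: H ij gij.
    by apply: (H j i) => //; rewrite eq_sym.
  by move: ij; rewrite -(inj_eq val_inj) /= e eqxx.
pose p := j - i.
have per m : i <= m -> f (wpow w (m + p)) = f (wpow w m).
  move=> /subnK <-; rewrite -addnA /p (subnKC (ltnW lt_ij)) !wpowD.
  exact: cf.
have perq m q : i <= m -> f (wpow w (m + q * p)) = f (wpow w m).
  move=> im; elim: q => [|q IH]; first by rewrite addn0.
  by rewrite mulSnr addnA per ?IH // (leq_trans im) ?leq_addr.
have p0 : 0 < p by rewrite subn_gt0.
have r0 : 0 < i.+1 * p by rewrite muln_gt0.
exists (i.+1 * p).-1; rewrite prednK // -wpowD perq //.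
by rewrite (leq_trans (leqnSn i)) // leq_pmulr.
Qed.

(** For constant [h] this is ordinary aperiodicity. A general [h] constrains only words with
    idempotent [h]-class, so the groups coming from languages of [C] are allowed. *)
Definition aperiodic_over (M N : Type) (f : seq A -> M) (h : seq A -> N) :=
  forall w, h (w ++ w) = h w -> exists k, f (wpow w k) = f (wpow w k.+1).

Lemma congruence_pair (M N : Type) (f : seq A -> M) (g : seq A -> N) :
  congruence f -> congruence g -> congruence (fun w => (f w, g w)).
Proof.
by move=> cf cg x x' y y' [e1 e2] [e3 e4]; congr (_, _); [apply: cf|apply: cg].
Qed.

(** The set component of the Schützenberger product, which recognizes concatenations. *)
Definition splits (M N : finType) (f : seq A -> M) (g : seq A -> N) w
    : {set M * N} :=
  [set p | `[< exists x y, [/\ w = x ++ y, f x = p.1 & g y = p.2] >]].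

Lemma splitsP (M N : finType) (f : seq A -> M) (g : seq A -> N) w p :
  reflect (exists x y, [/\ w = x ++ y, f x = p.1 & g y = p.2])
          (p \in splits f g w).
Proof. by rewrite inE; exact: asboolP. Qed.

(* The pairs of a product [u v] split inside [u] or inside [v]; in both cases
   the classes of the two pieces only depend on the classes of [u] and [v]. *)
Lemma congruence_splits (M N : finType) (f : seq A -> M) (g : seq A -> N) :
  congruence f -> congruence g ->
  congruence (fun w => ((f w, g w), splits f g w)).
Proof.
move=> cf cg.
have sub x x' y y' : f x = f x' -> g y = g y' ->
    splits f g x = splits f g x' -> splits f g y = splits f g y' ->
    splits f g (x ++ y) \subset splits f g (x' ++ y').
  move=> fx gy sx sy; apply/subsetP => -[s t] /splitsP[u [v [/= e <- <-]]].
  apply/splitsP; case: (cat_eq_cat e) => -[z [e1 e2]].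
    have : (f z, g v) \in splits f g y by apply/splitsP; exists z, v.
    rewrite sy => /splitsP[z' [v' [-> /= fz gv]]]; exists (x' ++ z'), v'.
    by split; rewrite ?catA //= e1; apply: cf.
  have : (f u, g z) \in splits f g x by apply/splitsP; exists u, z.
  rewrite sx => /splitsP[u' [z' [-> /= fu gz]]]; exists u', (z' ++ y').
  by split; rewrite ?catA //= e2; apply: cg.
move=> x x' y y' [fx gx sx] [fy gy sy]; congr (_, _, _); [exact: cf|exact: cg|].
by apply/eqP; rewrite eqEsubset !sub.
Qed.

Lemma aperiodic_splits (M N M' N' : finType) (f : seq A -> M) (g : seq A -> N)
    (h : seq A -> M') (l : seq A -> N') :
  congruence f -> congruence g -> aperiodic_over f h -> aperiodic_over g l ->
  aperiodic_over (fun w => ((f w, g w), splits f g w)) (fun w => (h w, l w)).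
Proof.
move=> cf cg af ag w [/af[k1 e1] /ag[k2 e2]].
pose k := maxn k1 k2.
have fk n : k <= n -> f (wpow w n) = f (wpow w n.+1).
  by move=> kn; apply: congr_wpow_le e1 _ => //; rewrite (leq_trans _ kn) // leq_maxl.
have gk n : k <= n -> g (wpow w n) = g (wpow w n.+1).
  by move=> kn; apply: congr_wpow_le e2 _ => //; rewrite (leq_trans _ kn) // leq_maxr.
(* A cut of the [n]-th power leaves [2k] whole copies, so at least [k] on one side, where a copy can
   be added. A cut of the next power leaves [2k+1], so more than [k] on one side, where a copy can
   be removed. *)
pose n := k + k.+1; exists n; congr (_, _, _).
- by apply: fk; rewrite leq_addr.
- by apply: gk; rewrite leq_addr.
rewrite /n addnS; apply/setP => -[s t].
apply/splitsP/splitsP => -[x [y [/= /wpow_split e <- <-]]];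
  case: e => i [j [x' [y' [ij wE -> ->]]]].
- have [ki|lt_ik] := leqP k i.
    exists (wpow w i.+1 ++ x'), (y' ++ wpow w j); split=> //=.
      by rewrite ij -addSn wE wpow_join.
    by apply: cf => //; rewrite -fk.
  have kj : k <= j.
    by rewrite -(leq_add2l k) ij leq_add2r ltnW.
  exists (wpow w i ++ x'), (y' ++ wpow w j.+1); split=> //=.
    by rewrite ij -addnS wE wpow_join.
  by apply: cg => //; rewrite -gk.
- have [lt_ki|le_ik] := ltnP k i.
    case: i lt_ki ij => // i ki; rewrite addSn => -[ij].
    exists (wpow w i ++ x'), (y' ++ wpow w j); split=> //=.
      by rewrite ij wE wpow_join.
    by apply: cf => //; rewrite -fk.
  have : k < j by rewrite -(leq_add2l k) addnS ij leq_add2r.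
  case: j ij => // j; rewrite addnS => -[ij] kj.
  exists (wpow w i ++ x'), (y' ++ wpow w j); split=> //=.
    by rewrite ij wE wpow_join.
  by apply: cg => //; rewrite -gk.
Qed.

End Congruences.

(** * Recognition of [SF C] by congruences aperiodic over [C] *)

Section Recognizers.
Variables (A : finType) (C : lang A -> Prop).
Hypothesis pvC : prevariety C.
Implicit Types (L : lang A) (x y u v w : seq A).

Lemma boolean_prevariety : boolean_class C.
Proof. by case: pvC => -[ext _ _ CT] [CU _ CN _ _]; split. Qed.

Lemma boolean_SF : boolean_class (SF C).
Proof.
case: pvC => -[_ _ _ CT] _.
by split; [exact: SF_ext | exact: SF_base | exact: SF_compl | exact: SF_union].
Qed.

(** By induction on [w]; the empty word is what remains after removing, for each letter [a], the
    words starting with [a]. *)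
Lemma SF_eq w : SF C (fun v => v = w).
Proof.
have bS := boolean_SF.
elim: w => [|a w IH]; last first.
  apply: (SF_ext (SF_concat (SF_letter C a) IH)) => v.
  by split=> [[_ [_ [-> [-> ->]]]]|->] //; exists [:: a], w.
have bC := boolean_prevariety.
have S1 : SF C (fun v => exists a, concat (fun w => w = [:: a]) (fun=> True) v).
  apply: (bool_exists bS) => a; apply: SF_concat; first exact: SF_letter.
  exact: (bool_const bS).
apply: (SF_ext (SF_compl S1)) => -[|a v]; split=> //.
  by move=> _ [b [u [v [e [uE _]]]]]; rewrite uE in e.
by case; exists a, [:: a], v.
Qed.

Lemma fibers_eq w : fibers_in (SF C) (eq_op^~ w).
Proof.
case; first by apply: (SF_ext (SF_eq w)) => v; split=> /eqP.
apply: (SF_ext (SF_compl (SF_eq w))) => v.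
by split=> [/eqP/negbTE|/negbT/eqP].
Qed.

Lemma fibers_splits (M N : finType) (f : seq A -> M) (g : seq A -> N) :
  fibers_in (SF C) f -> fibers_in (SF C) g -> fibers_in (SF C) (splits f g).
Proof.
move=> Sf Sg; apply: (fibers_set boolean_SF) => p.
apply: (SF_ext (SF_concat (Sf p.1) (Sg p.2))) => w; split.
  by case=> x [y [-> [fx gy]]]; apply/splitsP; exists x, y.
by case/splitsP=> x [y [-> fx gy]]; exists x, y.
Qed.

(* The syntactic congruence of a language of [C]: a context [(x, y)] of [w] is
   abstracted by the state reached on [x] and the set of states accepting [y],
   so there are finitely many contexts, and each is a quotient of [L]. *)
Lemma syntactic_congruence L : C L ->
  exists (N : finType) (h : seq A -> N),
    [/\ congruence h, fibers_in C h & forall x y, h x = h y -> L x -> L y].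
Proof.
move=> CL; case: (pvC) => -[extC regC _ _] [_ _ _ lqC rqC].
have bC := boolean_prevariety.
have [Q [q0 [d [F LE]]]] := regC L CL.
pose st x := foldl d q0 x.
pose acc y := [set q | F (foldl d q y)].
have LE3 x w y : L (x ++ w ++ y) <-> foldl d (st x) w \in acc y.
  by rewrite LE !foldl_cat inE.
pose h w := [set p : Q * {set Q} |
  `[< exists x y, [/\ st x = p.1, acc y = p.2 & L (x ++ w ++ y)] >]].
have hP w x y : reflect (L (x ++ w ++ y)) ((st x, acc y) \in h w).
  apply: (iffP idP) => [|Lw]; rewrite inE.
    by case/asboolP=> x' [y' [/= ex ey]]; rewrite !LE3 ex ey.
  by apply/asboolP; exists x, y.
have hE w w' : (forall x y, L (x ++ w ++ y) <-> L (x ++ w' ++ y)) -> h w = h w'.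
  move=> H; apply/setP => p; rewrite !inE; apply/asboolP/asboolP;
  by case=> x [y [e1 e2 /H Lw]]; exists x, y.
have hL w w' : h w = h w' -> forall x y, L (x ++ w ++ y) <-> L (x ++ w' ++ y).
  by move=> e x y; split=> /hP hw; apply/hP; [rewrite -e|rewrite e].
exists {set Q * {set Q}}, h; split.
- move=> x x' y y' /hL ex /hL ey; apply: hE => u v.
  rewrite -!catA ex; move: (ey (u ++ x') v); rewrite -!catA; exact.
- apply: (fibers_set bC) => -[q T].
  have [[x [y [<- <-]]]|none] := pselect (exists x y, st x = q /\ acc y = T).
    have CQ := lqC _ x (rqC _ y CL).
    by apply: (extC _ _ CQ) => w; rewrite -catA; split=> /hP.
  apply: (bool_ext bC (bool_const bC False)) => w; split=> //.
  rewrite inE => /asboolP[x [y [/= e1 e2 _]]]; apply: none; by exists x, y.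
- by move=> x y /hL/(_ [::] [::]); rewrite /= !cats0 => -[].
Qed.

(** Languages of [C] take [f = h], their syntactic congruence; letters take a constant [h];
    complement keeps the recognizer; union and concatenation pair two recognizers and add
    [splits]. *)
Lemma SF_recognizer L : SF C L ->
  exists (M N : finType) (f : seq A -> M) (h : seq A -> N),
    [/\ congruence f, congruence h, fibers_in C h, fibers_in (SF C) f
      & aperiodic_over f h] /\
    (forall x y, f x = f y -> L x -> L y).
Proof.
have bC := boolean_prevariety; have bS := boolean_SF.
elim=> {L} [L CL|a|L1 L2 _ IH1 _ IH2|L _ IH|L1 L2 _ IH1 _ IH2|L L' _ IH LL'].
- have [N [h [ch Ch hL]]] := syntactic_congruence CL.
  exists N, N, h, h; split=> //; split=> //; first by move=> n; apply: SF_base.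
  by move=> w e; exists 1; rewrite /wpow /= cats0 e.
- pose f w := (w == [::], w == [:: a]).
  exists (bool * bool)%type, unit, f, (fun=> tt); split; last first.
    by move=> x y [_ e] xE; apply/eqP; rewrite -e; apply/eqP.
  split=> //.
  + have fE x y : f (x ++ y) = ((f x).1 && (f y).1,
                                 (f x).1 && (f y).2 || (f x).2 && (f y).1).
      case: x => [|b [|b' x]] /=; rewrite /f /= ?orbF //;
        last by rewrite !eqseq_cons andbF.
      by case: y => [|c y]; rewrite /= ?andbT ?andbF // eqseq_cons andbF.
    by move=> x x' y y' ex ey; rewrite !fE ex ey.
  + by case; apply: (bool_ext bC (bool_const bC True)).
  + by apply: (fibers_pair bS); exact: fibers_eq.
  (* The square and the cube of a nonempty word both have length at least 2, hence are neither empty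
     nor [[:: a]]. *)
  + move=> w _; exists 2; case: w => [|b w] //.
    by rewrite /f /wpow /= !cats0; case: w.
- have [M1 [N1 [f1 [h1 [[cf1 ch1 Ch1 Sf1 a1] L1f]]]]] := IH1.
  have [M2 [N2 [f2 [h2 [[cf2 ch2 Ch2 Sf2 a2] L2f]]]]] := IH2.
  exists _, _, (fun w => ((f1 w, f2 w), splits f1 f2 w)), (fun w => (h1 w, h2 w)).
  split; last first.
    by move=> x y [e1 e2 _] [/(L1f _ _ e1)|/(L2f _ _ e2)]; [left|right].
  split; [exact: congruence_splits|exact: congruence_pair| | |].
  + exact: (fibers_pair bC).
  + by apply: (fibers_pair bS); [exact: (fibers_pair bS)|exact: fibers_splits].
  + exact: aperiodic_splits.
- have [M [N [f [h [Hf Lf]]]]] := IH; exists M, N, f, h; split=> //.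
  by move=> x y e nLx Ly; apply: nLx; apply: Lf Ly.
- have [M1 [N1 [f1 [h1 [[cf1 ch1 Ch1 Sf1 a1] L1f]]]]] := IH1.
  have [M2 [N2 [f2 [h2 [[cf2 ch2 Ch2 Sf2 a2] L2f]]]]] := IH2.
  exists _, _, (fun w => ((f1 w, f2 w), splits f1 f2 w)), (fun w => (h1 w, h2 w)).
  split.
    split; [exact: congruence_splits|exact: congruence_pair| | |].
    * exact: (fibers_pair bC).
    * by apply: (fibers_pair bS); [exact: (fibers_pair bS)|exact: fibers_splits].
    * exact: aperiodic_splits.
  move=> x y [_ _ e] [u [v [xE [L1u L2v]]]].
  have : (f1 u, f2 v) \in splits f1 f2 x by apply/splitsP; exists u, v.
  rewrite e => /splitsP[u' [v' [-> /= /esym/L1f L1u' /esym/L2f L2v']]].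
  by exists u', v'; split=> //; split; [apply: L1u'|apply: L2v'].
- have [M [N [f [h [Hf Lf]]]]] := IH; exists M, N, f, h; split=> //.
  by move=> x y e /LL' Lx; apply/LL'; apply: Lf Lx.
Qed.
End Recognizers.

(** * Positions of a word, their types, and modalities as factorizations *)

Section Positions.
Variable A : finType.
Implicit Types (L : lang A) (p x s u v w : seq A) (phi psi : formula A).

(** The infix [x] read by the modality is a prefix of the suffix [drop i w], and the target is
    position [i + size x + 1], since positions count from 0 and letters from 1. *)
Lemma sat_until w i L phi psi : i <= size w ->
  sat w i (FUntil L phi psi) <->
  exists x s, [/\ drop i w = x ++ s, L x, sat w (i + size x).+1 psi
    & forall k, i < k <= i + size x -> sat w k phi].
Proof.
move=> iw; split=> /= [[j [ij jw Lx q pk]]|[x [s [e Lx q pk]]]].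
  case: j ij jw Lx q pk => // j; rewrite !ltnS => ij jw Lx q pk.
  have sx : size (drop i (take j w)) = j - i by rewrite size_drop size_takel.
  exists (drop i (take j w)), (drop j w); rewrite sx subnKC //; split=> //.
  by rewrite -{1}(cat_take_drop (j - i) (drop i w)) take_drop drop_drop subnK.
have le : i + size x <= size w.
  have := congr1 size e; rewrite size_drop size_cat => /(congr1 (addn i)).
  by rewrite subnKC // => ->; rewrite addnA leq_addr.
exists (i + size x).+1; split; rewrite ?ltnS ?leq_addr //.
by rewrite /infix_between /= addnC -take_drop e take_size_cat.
Qed.

Lemma sat_since w i L phi psi : i <= size w ->
  sat w i.+1 (FSince L phi psi) <->
  exists p x, [/\ take i w = p ++ x, L x, sat w (size p) psi
    & forall k, size p < k <= i -> sat w k phi].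
Proof.
move=> iw; split=> /= [[j [ji Lx q pk]]|[p [x [e Lx q pk]]]].
  have sp : size (take j (take i w)) = j by rewrite !size_takel // size_takel.
  exists (take j (take i w)), (drop j (take i w)).
  by rewrite cat_take_drop sp; split.
exists (size p); split=> //; last by rewrite /infix_between /= e drop_size_cat.
by rewrite ltnS -(size_takel iw) e size_cat leq_addr.
Qed.

(** The two levels of option separate the unlabeled ends: [None] at position 0, [Some None] at
    position [size w + 1]. *)
Definition label w i : option (option A) := if i is k.+1 then Some (onth w k) else None.

Definition ptype (M : Type) (f : seq A -> M) w i :=
  (f (take i.-1 w), label w i, f (drop i w)).

Lemma label_cat u s : label (u ++ s) (size u).+1 = Some (ohead s).
Proof. by rewrite /label onth_cat ltnn subnn; case: s. Qed.

Lemma ptype_cat M (f : seq A -> M) u s :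
  ptype f (u ++ s) (size u).+1 = (f u, Some (ohead s), f (behead s)).
Proof.
rewrite /ptype label_cat take_size_cat //; congr (_, _, f _).
by rewrite -add1n -drop_drop drop_size_cat // drop1.
Qed.

Lemma ptype_catl M (f : seq A -> M) p s :
  ptype f (p ++ s) (size p) = (f (take (size p).-1 p), label p (size p), f s).
Proof.
rewrite /ptype drop_size_cat // takel_cat ?leq_pred //; congr (_, _, _).
by case: p => // a p; have := onth_cat (a :: p) s (size p); rewrite ltnSn /= => ->.
Qed.

Lemma label_max w i : i <= (size w).+1 ->
  label w i = Some None <-> i = (size w).+1.
Proof.
case: i => // i; rewrite ltnS leq_eqVlt => /predU1P[->|lt].
  by split=> // _; rewrite /label onth_default.
split=> [[e]|[e]]; last by rewrite e ltnn in lt.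
by move: lt; rewrite -onthTE e.
Qed.

Lemma take_onth i w : take i.+1 w = take i w ++ oapp (cons^~ [::]) [::] (onth w i).
Proof. by elim: w i => [|a w IH] [|i] //=; rewrite ?take0 ?IH. Qed.

Lemma drop_onth i w : drop i w = oapp (cons^~ [::]) [::] (onth w i) ++ drop i.+1 w.
Proof. by elim: w i => [|a w IH] [|i] //=; rewrite ?drop0 -?IH. Qed.

Lemma take_ptype M (f : seq A -> M) w w' i i' : congruence f ->
  ptype f w i = ptype f w' i' -> f (take i w) = f (take i' w').
Proof.
move=> cf; case: i i' => [|i] [|i'] //; first by rewrite !take0.
case=> e1 e2 e3; by rewrite !take_onth e2; apply: cf.
Qed.

Lemma drop_ptype M (f : seq A -> M) w w' i i' : congruence f ->
  ptype f w i.+1 = ptype f w' i'.+1 -> f (drop i w) = f (drop i' w').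
Proof. by move=> cf [_ e2 e3]; rewrite drop_onth (drop_onth i') e2; apply: cf. Qed.

(** What a suffix [s] contributes to the type of the position where it begins (the last position of
    the word if [s] is empty). Dually, [last_data] concerns the position where a prefix ends, which
    is 0 for the empty prefix. *)
Definition head_data M (f : seq A -> M) s := (ohead s, f s, f (behead s)).
Definition last_data M (f : seq A -> M) p :=
  (label p (size p), f p, f (take (size p).-1 p)).

(* [splits f (head_data f) x] records the types, relative to [x], of all
   positions of [x], so it determines their types in any context. *)
Lemma inner_ptype (M : finType) (f : seq A -> M) p p' x x' s s' k' :
  congruence f -> f p = f p' -> f s = f s' ->
  splits f (head_data f) x = splits f (head_data f) x' ->
  size p' < k' <= size p' + size x' ->
  exists2 k, size p < k <= size p + size x &
    ptype f (p ++ x ++ s) k = ptype f (p' ++ x' ++ s') k'.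
Proof.
move=> cf ep es ex /andP[lt le].
pose l := k' - (size p').+1.
have k'E : k' = (size p' + l).+1 by rewrite -addSn subnKC.
have lx : l < size x' by rewrite k'E -addnS leq_add2l in le.
have : (f (take l x'), head_data f (drop l x')) \in splits f (head_data f) x'.
  by apply/splitsP; exists (take l x'), (drop l x'); rewrite cat_take_drop.
rewrite -ex => /splitsP[x1 [y [xE /= f1 [hy fy fy']]]].
move: hy fy fy'; case dE : (drop l x') => [|b x2'] /=.
  by move/(congr1 size): dE; rewrite size_drop /= => /eqP; rewrite subn_eq0 leqNgt lx.
case: y xE => // b' x2 xE [bE] fy fx2.
exists (size (p ++ x1)).+1.
  by rewrite xE !size_cat /= ltnS leq_addr addnA addnS ltnS leq_addr.
have wE : p ++ x ++ s = (p ++ x1) ++ (b' :: x2 ++ s) by rewrite xE -!catA.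
have wE' : p' ++ x' ++ s' = (p' ++ take l x') ++ (b :: x2' ++ s').
  by rewrite -{1}(cat_take_drop l x') dE -!catA.
have -> : k' = (size (p' ++ take l x')).+1.
  by rewrite size_cat size_takel ?(ltnW lx).
by rewrite wE wE' !ptype_cat /=; rewrite bE (cf _ _ _ _ ep f1) (cf _ _ _ _ fx2 es).
Qed.
End Positions.

(** * From formulas with past to star-free closure *)

Section LTLPtoSF.
Variables (A : finType) (C : lang A -> Prop).
Hypothesis pvC : prevariety C.
Implicit Types (L : lang A) (p x s u v w : seq A) (phi psi : formula A).

(** The product of recognizers of the finitely many fibers of [f]. It turns data such as nested
    [splits] into a congruence. *)
Lemma SF_refine_congruence (T : finType) (f : seq A -> T) :
  fibers_in (SF C) f ->
  exists (M : finType) (g : seq A -> M),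
    [/\ congruence g, fibers_in (SF C) g & forall x y, g x = g y -> f x = f y].
Proof.
move=> Sf; have bS := boolean_SF pvC.
have [M [g [cg Sg gf]]] : exists (M : finType) (g : seq A -> M),
    [/\ congruence g, fibers_in (SF C) g &
        forall t, t \in enum T -> forall x y, g x = g y -> f x = t -> f y = t].
  elim: (enum T) => [|t s [M [g [cg Sg gf]]]].
    exists unit, (fun=> tt); split=> //.
    by case; apply: (bool_ext bS (bool_const bS True)).
  have [M' [_ [g' [_ [[cg' _ _ Sg' _] gt]]]]] := SF_recognizer pvC (Sf t).
  exists (M' * M)%type, (fun w => (g' w, g w)); split.
  - exact: congruence_pair.
  - exact: (fibers_pair bS).
  - move=> t'; rewrite inE => /predU1P[->|ts] x y [e1 e2]; first exact: gt.
    exact: gf.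
by exists M, g; split=> // x y e; rewrite (gf (f x) _ x y e) ?mem_enum.
Qed.

Lemma fibers_head_data (M : finType) (f : seq A -> M) :
  fibers_in (SF C) f -> fibers_in (SF C) (head_data f).
Proof.
move=> Sf; have bS := boolean_SF pvC.
apply: (fibers_pair bS); first apply: (fibers_pair bS) => //.
- case=> [a|].
    apply: (SF_ext (SF_concat (SF_letter C a) (bool_const bS True))) => w.
    split=> [[_ [v [-> [-> _]]]] //|]; case: w => // b w [->].
    by exists [:: a], w.
  by apply: (SF_ext (SF_eq pvC [::])) => -[].
- move=> m; apply: (bool_ext bS (bool_or bS
    (bool_and bS (SF_eq pvC [::]) (bool_const bS (f [::] = m)))
    (bool_exists bS (fun a => SF_concat (SF_letter C a) (Sf m))))) => w.
  split=> [[[-> //]|[a [_ [v [-> [-> fv]]]]] //]|].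
  by case: w => [|a w] e; [left|right; exists a, [:: a], w].
Qed.

Lemma fibers_last_data (M : finType) (f : seq A -> M) :
  fibers_in (SF C) f -> fibers_in (SF C) (last_data f).
Proof.
move=> Sf; have bS := boolean_SF pvC.
have take_rcons w a : take (size (w ++ [:: a])).-1 (w ++ [:: a]) = w.
  by rewrite size_cat addn1 take_size_cat.
have label_rcons w a : label (w ++ [:: a]) (size (w ++ [:: a])) = Some (Some a).
  by rewrite size_cat addn1 label_cat.
apply: (fibers_pair bS); first apply: (fibers_pair bS) => //.
- case=> [[a|]|].
  + apply: (SF_ext (SF_concat (bool_const bS True) (SF_letter C a))) => w.
    split=> [[v [_ [-> [_ ->]]]]|]; first by rewrite label_rcons.
    case/lastP: w => // w b; rewrite -cats1 label_rcons => -[->].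
    by exists w, [:: a].
  + apply: (bool_ext bS (bool_const bS False)) => w; split=> // /label_max.
    by move/(_ (leqnSn _))/eqP; rewrite -[X in X == _]addn0 -addn1 eqn_add2l.
  + by apply: (SF_ext (SF_eq pvC [::])) => -[].
- move=> m; apply: (bool_ext bS (bool_or bS
    (bool_and bS (SF_eq pvC [::]) (bool_const bS (f [::] = m)))
    (bool_exists bS (fun a => SF_concat (Sf m) (SF_letter C a))))) => w.
  split=> [[[-> //]|[a [v [_ [-> [fv ->]]]]]]|]; first by rewrite take_rcons.
  case/lastP: w => [|w a] e; [by left|right; exists a, w, [:: a]].
  by move: e; rewrite -cats1 take_rcons.
Qed.

(** An implication suffices, the conditions being symmetric in the two pointed words. *)
Definition determines (M : Type) (f : seq A -> M) phi :=
  forall w w' i i', i <= (size w).+1 -> i' <= (size w').+1 ->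
    ptype f w i = ptype f w' i' -> sat w i phi -> sat w' i' phi.

Lemma determines_refine (M M' : Type) (f : seq A -> M) (g : seq A -> M') phi :
  (forall x y, g x = g y -> f x = f y) -> determines f phi -> determines g phi.
Proof.
move=> gf df w w' i i' iw iw' [e1 e2 e3]; apply: df => //.
by rewrite /ptype e2 (gf _ _ e1) (gf _ _ e3).
Qed.

Section Modalities.
Variables (M M' : finType) (f : seq A -> M) (g : seq A -> M').
Variables (L : lang A) (phi psi : formula A).
Hypotheses (cf : congruence f) (cg : congruence g).
Hypothesis (fL : forall x y, f x = f y -> L x -> L y).
Hypotheses (dphi : determines f phi) (dpsi : determines f psi).

Let inner x := (f x, splits f (head_data f) x).

(** The class of [drop i w] under [g] fixes which data its cuts [x ++ s] realize. A witness in [w]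
    thus gives a cut in [w'] with the same [f x], hence the same membership in [L], the same types
    inside [x] by [inner], and the same type at the target by [head_data]. *)
Lemma determines_until :
  (forall x y, g x = g y ->
     f x = f y /\ splits inner (head_data f) x = splits inner (head_data f) y) ->
  determines g (FUntil L phi psi).
Proof.
move=> gf w w' i i' iw iw' e.
have ef : ptype f w i = ptype f w' i'.
  by case: e => e1 e2 e3; rewrite /ptype e2 (gf _ _ e1).1 (gf _ _ e3).1.
(* The last position is recognized by its label, so not being last transfers along equal types. *)
have le_iw' : i <= size w -> i' <= size w'.
  move=> le; rewrite -ltnS ltn_neqAle iw' andbT; apply/eqP.
  move/(label_max iw'); case: ef => _ <- _ /(label_max iw) iE.
  by rewrite iE ltnn in le.
move=> sw; have le : i <= size w.
  by case: sw => j [ij jw _ _ _]; rewrite -ltnS (leq_trans ij).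
have le' := le_iw' le; apply/(sat_until _ _ _ le').
have [x [s [dE Lx q pk]]] := (sat_until _ _ _ le).1 sw.
have ep := take_ptype cf ef.
have wE : w = take i w ++ x ++ s by rewrite -dE cat_take_drop.
case: e => _ _ /gf[_ ed].
have : (inner x, head_data f s) \in splits inner (head_data f) (drop i w).
  by apply/splitsP; exists x, s.
rewrite ed => /splitsP[x' [s' [dE' /= [fx bx] [hs fs fs']]]].
have wE' : w' = take i' w' ++ x' ++ s' by rewrite -dE' cat_take_drop.
have sp : size (take i w) = i by rewrite size_takel.
have sp' : size (take i' w') = i' by rewrite size_takel.
have lew : i + size x <= size w.
  by rewrite -{1}sp -size_cat [w in X in _ <= X]wE catA [X in _ <= X]size_cat leq_addr.
have lew' : i' + size x' <= size w'.
  by rewrite -{1}sp' -size_cat [w' in X in _ <= X]wE' catA [X in _ <= X]size_cat leq_addr.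
exists x', s'; split=> //; first exact: fL Lx.
  apply: dpsi q => //.
  rewrite -{1}sp -{1}sp' -!size_cat {1}wE {1}wE' !catA !ptype_cat hs fs'.
  by rewrite (cf ep (esym fx)).
move=> k' /andP[ik' kx'].
have [|k kx ek] := inner_ptype (k' := k') cf ep (esym fs) (esym bx).
  by rewrite sp' ik'.
rewrite -wE -wE' sp in kx ek; case/andP: (kx) => _ lek.
apply: dphi (pk k kx) => //; first exact: leqW (leq_trans lek lew).
exact: leqW (leq_trans kx' lew').
Qed.

(** Mirror image of the until case: the prefix to the left of the position is cut, and the target is
    where the left piece ends. *)
Lemma determines_since :
  (forall x y, g x = g y ->
     f x = f y /\ splits (last_data f) inner x = splits (last_data f) inner y) ->
  determines g (FSince L phi psi).
Proof.
move=> gf w w' i i' iw iw' e.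
have ef : ptype f w i = ptype f w' i'.
  by case: e => e1 e2 e3; rewrite /ptype e2 (gf _ _ e1).1 (gf _ _ e3).1.
case: i i' iw iw' e ef => [|i] [|i'] // le le' e ef; first by case=> j [].
rewrite !ltnS in le le'.
case/(sat_since _ _ _ le) => p [x [tE Lx q pk]]; apply/(sat_since _ _ _ le').
have es := drop_ptype cf ef.
have wE : w = p ++ x ++ drop i w by rewrite catA -tE cat_take_drop.
case: e => /gf[_ /= ed] _ _.
have : (last_data f p, inner x) \in splits (last_data f) inner (take i w).
  by apply/splitsP; exists p, x.
rewrite ed => /splitsP[p' [x' [tE' /= [lp fp fp'] [fx bx]]]].
have wE' : w' = p' ++ x' ++ drop i' w' by rewrite catA -tE' cat_take_drop.
have sp : size p + size x = i by rewrite -size_cat -tE size_takel.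
have sp' : size p' + size x' = i' by rewrite -size_cat -tE' size_takel.
exists p', x'; split=> //; first exact: fL Lx.
  apply: dpsi q; first by rewrite (leq_trans _ (leqW le)) // -sp leq_addr.
    by rewrite (leq_trans _ (leqW le')) // -sp' leq_addr.
  by rewrite wE wE' !ptype_catl lp fp' (cf (esym fx) es).
move=> k' /andP[pk' ki'].
have [|k kx ek] := inner_ptype (k' := k') cf (esym fp) es (esym bx).
  by rewrite sp' pk'.
rewrite -wE -wE' sp in kx ek; case/andP: (kx) => _ lek.
apply: dphi (pk k kx) => //; first exact: leqW (leq_trans lek le).
exact: leqW (leq_trans ki' le').
Qed.

End Modalities.
Lemma sat_recognizer phi : Defs.over C phi ->
  exists (M : finType) (f : seq A -> M),
    [/\ congruence f, fibers_in (SF C) f & determines f phi].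
Proof.
have bS := boolean_SF pvC.
(* Atomic formulas read at most the label, which every type contains. *)
have atomic psi : determines (fun=> tt) psi ->
    exists (M : finType) (f : seq A -> M),
      [/\ congruence f, fibers_in (SF C) f & determines f psi].
  exists unit, (fun=> tt); split=> //.
  by case; apply: (bool_ext bS (bool_const bS True)).
have join psi1 psi2 :
    (exists (M : finType) (f : seq A -> M),
      [/\ congruence f, fibers_in (SF C) f & determines f psi1]) ->
    (exists (M : finType) (f : seq A -> M),
      [/\ congruence f, fibers_in (SF C) f & determines f psi2]) ->
    exists (M : finType) (f : seq A -> M),
      [/\ congruence f, fibers_in (SF C) f, determines f psi1 & determines f psi2].
  case=> M1 [f1 [c1 S1 d1]] [M2 [f2 [c2 S2 d2]]].
  exists (M1 * M2)%type, (fun w => (f1 w, f2 w)); split.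
  - exact: congruence_pair.
  - exact: (fibers_pair bS).
  - by apply: determines_refine d1 => x y [].
  - by apply: determines_refine d2 => x y [].
have modal L psi1 psi2 : C L ->
    (exists (M : finType) (f : seq A -> M),
      [/\ congruence f, fibers_in (SF C) f, determines f psi1 & determines f psi2]) ->
    exists (M : finType) (f : seq A -> M),
      [/\ congruence f, fibers_in (SF C) f,
        determines f (FUntil L psi1 psi2) & determines f (FSince L psi1 psi2)].
  move=> CL [M1 [f1 [c1 S1 d1 d2]]].
  have [M2 [_ [f2 [_ [[c2 _ _ S2 _] f2L]]]]] := SF_recognizer pvC (SF_base CL).
  pose f w := (f1 w, f2 w).
  have cf : congruence f by exact: congruence_pair.
  have Sf : fibers_in (SF C) f by exact: (fibers_pair bS).
  have fL x y : f x = f y -> L x -> L y by case=> _; apply: f2L.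
  have {}d1 : determines f psi1 by apply: determines_refine d1 => x y [].
  have {}d2 : determines f psi2 by apply: determines_refine d2 => x y [].
  have Sh := fibers_head_data Sf.
  have Si : fibers_in (SF C) (fun x => (f x, splits f (head_data f) x)).
    exact: (fibers_pair bS Sf (fibers_splits pvC Sf Sh)).
  (* One [g] serves both modalities: it refines [f], the cuts of suffixes for until and the cuts of
     prefixes for since. *)
  have [M [g [cg Sg gf]]] := SF_refine_congruence (fibers_pair bS Sf (fibers_pair bS
    (fibers_splits pvC Si Sh) (fibers_splits pvC (fibers_last_data Sf) Si))).
  exists M, g; split=> //.
    apply: (determines_until (f := f)) => // x y /gf e.
    by split; [exact: (congr1 fst e)|exact: (congr1 (fst \o snd) e)].
  apply: (determines_since (f := f)) => // x y /gf e.
  by split; [exact: (congr1 fst e)|exact: (congr1 (snd \o snd) e)].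
elim: phi => [_|_|_|a _|p IHp q IHq|p IHp q IHq|p IHp|L p IHp q IHq|L p IHp q IHq] /=.
- exact: atomic.
- by apply: atomic => w w' [|i] [|i'].
- apply: atomic => w w' i i' iw iw' [e] /= iE.
  by apply/(label_max iw'); rewrite -e; apply/label_max.
- apply: atomic => w w' [|i] [|i'] iw iw' //; first by move=> _ [].
  by case=> e; rewrite /= -!onthE e.
- case=> /IHp Hp /IHq Hq; have [M [f [cf Sf dp dq]]] := join _ _ Hp Hq.
  exists M, f; split=> // w w' i i' iw iw' e /= [sp|sq]; [left|right].
    exact: dp sp.
  exact: dq sq.
- case=> /IHp Hp /IHq Hq; have [M [f [cf Sf dp dq]]] := join _ _ Hp Hq.
  exists M, f; split=> // w w' i i' iw iw' e /= [sp sq]; split.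
    exact: dp sp.
  exact: dq sq.
- case/IHp=> M [f [cf Sf dp]]; exists M, f; split=> // w w' i i' iw iw' e /= nsp sp.
  by apply: nsp; apply: dp sp.
- case=> CL /IHp Hp /IHq Hq.
  by have [M [f [cf Sf du _]]] := modal _ _ _ CL (join _ _ Hp Hq); exists M, f.
- case=> CL /IHp Hp /IHq Hq.
  by have [M [f [cf Sf _ ds]]] := modal _ _ _ CL (join _ _ Hp Hq); exists M, f.
Qed.

Lemma LTLP_SF L : LTLP C L -> SF C L.
Proof.
case=> phi [/sat_recognizer[M [f [cf Sf df]]] dL].
apply: (fibers_determine (boolean_SF pvC) Sf) => x y e /dL sx; apply/dL.
(* At position 0 only the right component of the type varies, and it is the class of the whole
   word. *)
by apply: df sx; rewrite // /ptype !take0 !drop0 e.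
Qed.

End LTLPtoSF.

(** * Sets of suffixes definable by future formulas *)

Section FutureLanguages.
Variables (A : finType) (C : lang A -> Prop).
Implicit Types (L P Q : lang A) (x y u v w : seq A).

(** Unlike [FUntil], this until is not strict: [x] may be empty, and otherwise [P] is also required
    of [v] itself. *)
Definition until L P Q : lang A := fun v => exists x y,
  [/\ v = x ++ y, L x, Q y & forall x1 x2, x = x1 ++ x2 -> x2 <> [::] -> P (x2 ++ y)].

Lemma untilE L P Q v : until L P Q v <-> exists x y,
  [/\ v = x ++ y, L x, Q y & forall l, l < size x -> P (drop l v)].
Proof.
split=> -[x [y [-> Lx Qy Px]]]; exists x, y; split=> //.
  move=> l lx; rewrite drop_cat lx; apply: (Px (take l x)); first by rewrite cat_take_drop.
  by move/(congr1 size)/eqP; rewrite size_drop subn_eq0 leqNgt lx.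
move=> x1 x2 xE x2n; have := Px (size x1); rewrite xE -catA drop_size_cat //.
by apply; rewrite size_cat -addn1 leq_add2l; case: x2 x2n {xE}.
Qed.

Definition starts (a : A) : lang A := fun v => ohead v = Some a.

Definition tail_in L : lang A := fun v => v <> [::] /\ L (behead v).

(* A future formula evaluated at a position [i >= 1] only sees the suffix
   starting at [i] (empty when [i] is the last position): [future C B] are the
   sets of suffixes so defined, up to equality on the words over [B]. *)
Inductive future (B : {set A}) : lang A -> Prop :=
| future_true : future B (fun _ => True)
| future_starts a : future B (starts a)
| future_or P Q : future B P -> future B Q -> future B (fun w => P w \/ Q w)
| future_not P : future B P -> future B (fun w => ~ P w)
| future_next P : future B P -> future B (tail_in P)
| future_until L P Q : C L -> future B P -> future B Q -> future B (until L P Q)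
| future_ext P P' : future B P ->
    (forall w, all (mem B) w -> (P w <-> P' w)) -> future B P'.

Lemma boolean_future B : boolean_class (future B).
Proof.
split; [|exact: future_true|exact: future_not|exact: future_or].
by move=> L L' fL LL'; apply: future_ext fL _ => w _.
Qed.

(** An until whose target is the empty suffix must read the whole word in [L]. *)
Lemma future_base B L : C L -> future B L.
Proof.
move=> CL; have bF := boolean_future B.
have fnil : future B (fun v => v = [::]).
  apply: (bool_ext bF (bool_not bF (future_next (future_true B)))) => -[|a v].
    by split=> // _ [].
  by split=> // -[].
apply: (bool_ext bF (future_until CL (future_true B) fnil)) => w; split.
  by case=> x [_ [-> Lx -> _]]; rewrite cats0.
by move=> Lw; exists w, [::]; rewrite cats0.
Qed.

End FutureLanguages.

Lemma future_sub (A : finType) (C C' : lang A -> Prop) (B : {set A}) P :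
  (forall L, C L -> C' L) -> future C B P -> future C' B P.
Proof.
move=> CC'.
elim=> {P} [|a|P Q _ IHP _ IHQ|P _ IHP|P _ IHP
  |L P Q /CC' CL _ IHP _ IHQ|P P' _ IHP PP'].
- exact: future_true.
- exact: future_starts.
- exact: future_or.
- exact: future_not.
- exact: future_next.
- exact: future_until.
- exact: future_ext IHP PP'.
Qed.

(** * Translation of future languages into formulas *)

Section Formulas.
Variables (A : finType) (C : lang A -> Prop).
Hypothesis pvC : prevariety C.
Implicit Types (L P Q : lang A) (x y u v w : seq A) (phi : formula A).

Definition FBot : formula A := FNot (FTop A).

Definition FNext phi := FUntil (fun _ => True) FBot phi.

Lemma sat_next w i phi : i <= size w -> sat w i (FNext phi) <-> sat w i.+1 phi.
Proof.
move=> iw; rewrite sat_until //; split=> [[x [s [e _ q pk]]]|q].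
  case: x e q pk => [|a x] e; first by rewrite addn0.
  move=> _ /(_ i.+1); by rewrite ltnSn /= addnS ltnS leq_addr => /(_ isT) [].
exists [::], (drop i w); rewrite addn0; split=> // k /andP[lt].
by rewrite leqNgt lt.
Qed.

Definition FBig (F : A -> formula A) := foldr (fun a => FOr (F a)) FBot (enum A).

Lemma sat_big w i F : sat w i (FBig F) <-> exists a, sat w i (F a).
Proof.
have H (s : seq A) :
    sat w i (foldr (fun a => FOr (F a)) FBot s) <-> exists2 a, a \in s & sat w i (F a).
  elim: s => [|a s IH] /=; first by split=> [[]|[]].
  split=> [[Fa|/IH[b bs Fb]]|[b]].
  - by exists a; rewrite ?mem_head.
  - by exists b; rewrite // inE bs orbT.
  - by rewrite inE => /predU1P[->|bs] Fb; [left|right; apply/IH; exists b].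
rewrite /FBig H; split=> [[a _ Fa]|[a Fa]]; exists a => //; by rewrite mem_enum.
Qed.

Lemma big_over F : (forall a, Defs.over C (F a)) -> Defs.over C (FBig F).
Proof. by move=> CF; rewrite /FBig; elim: (enum A) => //= a s IH; split. Qed.

Lemma big_future F : (forall a, future_only (F a)) -> future_only (FBig F).
Proof. by move=> CF; rewrite /FBig; elim: (enum A) => //= a s IH; split. Qed.

(* A non-strict until at [i] is either fulfilled at [i], or reads a letter [a]
   at [i] and is a strict until for the quotient of [L] by [a]. *)
Lemma future_formula P : future C [set: A] P ->
  exists phi, [/\ Defs.over C phi, future_only phi &
    forall w i, i <= size w -> (sat w i.+1 phi <-> P (drop i w))].
Proof.
case: (pvC) => -[extC _ _ CT] [_ _ _ lqC _].
elim=> {P} [|a|P Q _ [p [Cp fp sp]] _ [q [Cq fq sq]]|P _ [p [Cp fp sp]]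
  |P _ [p [Cp fp sp]]|L P Q CL _ [p [Cp fp sp]] _ [q [Cq fq sq]]
  |P P' _ [p [Cp fp sp]] PP'].
- by exists (FTop A); split.
- exists (FLetter a); split=> // w i iw /=; rewrite -onthE /starts drop_onth.
  rewrite leq_eqVlt in iw; case/predU1P: iw => [->|lt].
    by rewrite onth_default // drop_oversize //=; split=> [[]|].
  by case e : (onth w i) => [b|]; [split=> [[]|] | move: lt; rewrite -onthTE e].
- by exists (FOr p q); split=> // w i iw /=; rewrite sp ?sq.
- by exists (FNot p); split=> // w i iw /=; rewrite sp.
- exists (FAnd (FNot (FMax A)) (FNext p)); split=> // w i iw; rewrite /tail_in.
  rewrite -[sat _ _ _]/(_ <> _ /\ sat w i.+1 (FNext p)).
  move: iw; rewrite leq_eqVlt => /predU1P[->|lt].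
    by rewrite drop_oversize //; split=> [[]|[]].
  rewrite sat_next // sp // -drop1 drop_drop add1n.
  split=> -[_ Pd]; split=> //; first by move/(congr1 size)/eqP; rewrite size_drop subn_eq0 leqNgt lt.
  by case=> e; rewrite e ltnn in lt.
- pose step a := FAnd (FAnd (FLetter a) p) (FUntil (fun v => L (a :: v)) p q).
  pose now := if `[< L [::] >] then q else FBot.
  exists (FOr now (FBig step)); split.
  + split; first by rewrite /now; case: ifP.
    by apply: big_over => a; split=> //=; split=> //; apply: (lqC L [:: a]).
  + split; first by rewrite /now; case: ifP.
    by apply: big_future.
  + move=> w i iw; rewrite -[sat _ _ _]/(sat w i.+1 now \/ sat w i.+1 (FBig step)).
    rewrite sat_big.
    have nowE : sat w i.+1 now <-> L [::] /\ Q (drop i w).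
      by rewrite /now; case: asboolP => L0; [rewrite sq //; split=> [|[]] | split=> [[]|[]]].
    rewrite nowE; split.
      case=> [[L0 Qd]|[a [[/= [_ ia] Pp] un]]].
        exists [::], (drop i w); split=> // x1 x2.
        by case: x1 => // ->.
      have lt : i < size w by rewrite -onthTE onthE ia.
      have [x [s [dE Lx Qs Px]]] := (sat_until (fun v => L (a :: v)) p q lt).1 un.
      have de : drop i w = a :: x ++ s by rewrite drop_onth onthE ia dE.
      have le : i.+1 + size x <= size w.
        by rewrite -(subnKC lt) leq_add2l -size_drop dE size_cat leq_addr.
      apply/untilE; exists (a :: x), s; split=> //.
        by move: Qs; rewrite sq // addnC -drop_drop dE drop_size_cat.
      move=> [|l] lx; first by rewrite drop0; apply/sp.
      have lE : l.+1 + i < i.+1 + size x by rewrite addnC addSn ltnS leq_add2l.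
      rewrite drop_drop; apply/sp; first exact: leq_trans (ltnW lE) le.
      by apply: Px; rewrite lE andbT addSn !ltnS leq_addl.
    move=> /untilE[[|a x] [y [dE Lx Qy Px]]]; first by left; rewrite dE.
    have lt : i < size w.
      by rewrite -subn_gt0 -size_drop dE.
    have wi : onth w i = Some a.
      by move: lt dE; rewrite -onthTE drop_onth; case: onth => //= b _ [->].
    have de : drop i.+1 w = x ++ y by rewrite -add1n -drop_drop dE /= drop0.
    have le : i.+1 + size x <= size w.
      by rewrite -(subnKC lt) leq_add2l -size_drop de size_cat leq_addr.
    right; exists a; split; first split.
    * by rewrite /= -onthE.
    * by apply/sp => //; have := Px 0 isT; rewrite drop0.
    * apply/sat_until => //; exists x, y; split=> //.
        by apply/sq => //; rewrite addnC -drop_drop de drop_size_cat.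
      move=> [//|k] /andP[ik kx]; apply/sp; first by rewrite (leq_trans (ltnW kx)).
      have := Px (k - i); rewrite drop_drop subnK; last exact: ltnW.
      by apply; rewrite /= ltnS leq_subLR; move: kx; rewrite addSn ltnS.
- by exists p; split=> // w i iw; rewrite sp // PP' //; apply/allP => a; rewrite !inE.
Qed.

Lemma future_LTL L : future C [set: A] L -> LTL C L.
Proof.
(* The whole word is the suffix starting at position 1, whereas formulas are evaluated at 0; hence
   the next modality. *)
case/future_formula=> phi [Cphi fphi sphi]; exists (FNext phi); split=> //.
  by case: pvC => -[_ _ _ CT] _.
by move=> w; rewrite sat_next // sphi // drop0.
Qed.

End Formulas.

(** * Case where every letter of [B] is left invertible *)

Definition saturated (A : finType) (N : Type) (h : seq A -> N) : lang A -> Prop :=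
  fun L => forall x y, h x = h y -> L x -> L y.

Section Invertible.
Variables (A M N : finType) (f : seq A -> M) (h : seq A -> N) (B : {set A}).
Hypotheses (cf : congruence f) (ch : congruence h) (afh : aperiodic_over f h).
Hypothesis invB : forall b, b \in B -> exists y, f (rcons y b) = f [::].
Implicit Types (u v w : seq A).

Lemma left_inverse w : all (mem B) w -> exists w', f (w' ++ w) = f [::].
Proof.
elim: w => [|b w IH] /=; first by exists [::].
case/andP=> /invB[y ey] /IH[w' ew]; exists (w' ++ y).
have -> : (w' ++ y) ++ b :: w = w' ++ (rcons y b ++ w) by rewrite -cats1 -!catA.
by rewrite -ew; apply: cf => //; rewrite -{2}[w]cat0s; apply: cf.
Qed.

(** A left inverse [w'] of the [k]-th power of [w] cancels that power on both sides of the
    hypothesis. *)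
Lemma aperiodic_unit w : all (mem B) w ->
  (exists k, f (wpow w k) = f (wpow w k.+1)) -> f w = f [::].
Proof.
move=> Bw [k e]; have [w' ew] := left_inverse (all_wpow k Bw).
have H v : f (w' ++ (wpow w k ++ v)) = f v.
  by rewrite catA -{2}[v]cat0s; apply: cf.
by rewrite -(H w) -wpowSr -ew; apply: cf.
Qed.

(* With [z] a power of [v] inverting [v] under [f] and making [h (v z)]
   idempotent, [h u = h v] makes [h (u z)] idempotent too, so aperiodicity
   forces [f (u z)] to be trivial. *)
Lemma invertible_determined u v : all (mem B) u -> all (mem B) v ->
  h u = h v -> f u = f v.
Proof.
move=> Bu Bv e.
have [r er] := congr_idempotent_power v (congruence_pair cf ch).
case: er => ef eh.
have Bz : all (mem B) (wpow v r) by exact: all_wpow.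
have f1 : f (wpow v r.+1) = f [::].
  apply: aperiodic_unit; first exact: all_wpow.
  by exists 1; rewrite /wpow /= !cats0; rewrite /wpow /= in ef.
have f2 : f (u ++ wpow v r) = f [::].
  apply: aperiodic_unit; first by rewrite all_cat Bu.
  apply: afh; have e1 : h (u ++ wpow v r) = h (wpow v r.+1) by apply: ch.
  by rewrite e1 -eh; apply: ch.
have f3 : f ((u ++ wpow v r) ++ v) = f v by exact: (cf f2 (erefl (f v))).
by rewrite -f3 -catA -wpowSr -{1}[u]cats0; apply: cf.
Qed.

Lemma future_invertible m : future (saturated h) B (fun w => f w = m).
Proof.
(* [L] is the [h]-saturation of the fiber over [B]; it adds no word over [B], since there [h]
   determines [f]. *)
pose L w := exists v, [/\ all (mem B) v, h v = h w & f v = m].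
have CL : saturated h L by move=> x y e [v [Bv ev fv]]; exists v; rewrite -e.
apply: (future_ext (future_base B CL)) => w Bw; split=> [[v [Bv e <-]]|fw].
  exact: invertible_determined.
by exists w.
Qed.

End Invertible.

(** * The local divisor at a letter [c] *)

Section LocalDivisor.
Variables (A M N : finType) (f : seq A -> M) (h : seq A -> N) (B : {set A}).
Variable c : A.
Hypotheses (cf : congruence f) (ch : congruence h) (afh : aperiodic_over f h).
Implicit Types (u v w x y : seq A).

Local Notation B' := (B :\ c).

(** A chosen [c]-free word with classes [t]. Pairs realized by no such word get the empty word; they
    never occur as blocks of a word over [B]. *)
Definition rep (t : M * N) : seq A :=
  if pselect (exists u, all (mem B') u /\ (f u, h u) = t) is left e
  then projT1 (cid e) else [::].

Lemma repP u : all (mem B') u -> f (rep (f u, h u)) = f u /\ h (rep (f u, h u)) = h u.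
Proof.
move=> Bu; rewrite /rep; case: pselect => [e|]; last by case; exists u.
by case: (cid e) => u' /= [_ [-> ->]].
Qed.

Definition expand (ts : seq (M * N)) := flatten [seq c :: rep t | t <- ts].

Lemma expand_cat ts ts' : expand (ts ++ ts') = expand ts ++ expand ts'.
Proof. by rewrite /expand map_cat flatten_cat. Qed.

Lemma expand_wpow ts k : expand (wpow ts k) = wpow (expand ts) k.
Proof. by elim: k => // k IH; rewrite !wpowS expand_cat IH. Qed.

(** Values lie in the local divisor at [c], whose product of [xc] and [cy] is [xcy] and whose unit
    is the class of [c], the value at [[::]]. *)
Definition div_f ts := f (expand ts ++ [:: c]).
Definition div_h ts := h (expand ts).

Lemma congruence_div_h : congruence div_h.
Proof. by move=> x x' y y' ex ey; rewrite /div_h !expand_cat; apply: ch. Qed.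

(* [expand y ++ [:: c]] starts with [c], which can be lent to [expand x]. *)
Lemma congruence_div_f : congruence div_f.
Proof.
move=> x x' y y' ex ey; rewrite /div_f !expand_cat -!catA.
apply: (@etrans _ _ (f (expand x' ++ expand y ++ [:: c]))); last exact: cf.
have [z ->] : exists z, expand y ++ [:: c] = [:: c] ++ z.
  by case: y {ey} => [|t y]; eexists.
by rewrite !catA; apply: cf.
Qed.

Lemma aperiodic_div : aperiodic_over div_f div_h.
Proof.
move=> ts; rewrite /div_h expand_cat => /afh[k e]; exists k.
by rewrite /div_f !expand_wpow; apply: cf.
Qed.

(** The value lost is [f [::]], since [div_f] evaluates [f] only on words ending with [c]. *)
Lemma card_div :
  (forall y, f (rcons y c) <> f [::]) ->
  #|[set m | `[< exists ts, div_f ts = m >]]| < #|[set m | `[< exists w, f w = m >]]|.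
Proof.
move=> nc; apply: proper_card; apply/properP; split.
  apply/subsetP => m; rewrite !inE => /asboolP[ts <-]; apply/asboolP.
  by exists (expand ts ++ [:: c]).
exists (f [::]); rewrite inE; first by apply/asboolP; exists [::].
by apply/asboolP => -[ts]; rewrite /div_f cats1; apply: nc.
Qed.

(** * Blocks of a word between occurrences of [c] *)

Fixpoint pre w := if w is a :: w' then if a == c then [::] else a :: pre w' else [::].

(* The classes of the blocks of [w] that are closed by a [c]; [acc] is the part
   of the current block already read. *)
Fixpoint blocks acc w : seq (M * N) :=
  if w is a :: w' then
    if a == c then (f acc, h acc) :: blocks [::] w' else blocks (rcons acc a) w'
  else [::].

Lemma pre_cat x y : c \notin x -> pre (x ++ c :: y) = x.
Proof.
elim: x => [|a x IH] /=; first by rewrite eqxx.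
by rewrite inE negb_or eq_sym => /andP[/negbTE-> /IH->].
Qed.

Lemma pre_id x : c \notin x -> pre x = x.
Proof.
elim: x => [|a x IH] //=.
by rewrite inE negb_or eq_sym => /andP[/negbTE-> /IH->].
Qed.

Lemma all_pre w : all (mem B) w -> all (mem B') (pre w).
Proof.
elim: w => //= a w IH /andP[Ba /IH Bw]; case: eqP => //= ac.
by rewrite Bw andbT !inE Ba andbT; apply/eqP.
Qed.

Lemma blocks_cat acc x y :
  blocks acc (x ++ c :: y) = blocks acc (x ++ [:: c]) ++ blocks [::] y.
Proof.
elim: x acc => [|a x IH] acc /=; first by rewrite eqxx.
by case: eqP => _; rewrite IH.
Qed.

Lemma blocks_nil acc x : c \notin x -> blocks acc x = [::].
Proof.
elim: x acc => [|a x IH] acc //=.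
by rewrite inE negb_or eq_sym => /andP[/negbTE-> /IH->].
Qed.

Lemma blocks_first acc x y : c \notin x ->
  blocks acc (x ++ c :: y) = (f (acc ++ x), h (acc ++ x)) :: blocks [::] y.
Proof.
elim: x acc => [|a x IH] acc /=; first by rewrite eqxx cats0.
by rewrite inE negb_or eq_sym => /andP[/negbTE-> /IH->]; rewrite cat_rcons.
Qed.

(** Each block is closed by a [c], so a cut after some blocks is a cut of [w] right after a [c]. *)
Lemma blocks_split acc w ts ts' : blocks acc w = ts ++ ts' -> ts <> [::] ->
  exists x y, [/\ w = x ++ c :: y, blocks acc (x ++ [:: c]) = ts
               & blocks [::] y = ts'].
Proof.
elim: w acc ts => [|a w IH] acc [|t ts] //=; case: (a =P c) => [->|ac].
  case: ts => [|t' ts] [<- e] _.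
    by exists [::], w; rewrite /= eqxx.
  have [//|x [y [-> ex ey]]] := IH _ (t' :: ts) e.
  by exists (c :: x), y; rewrite /= eqxx ex.
move=> e _; have [//|x [y [-> ex ey]]] := IH _ (t :: ts) e.
by exists (a :: x), y; split=> //=; case: eqP.
Qed.

(** Stated for any [g] that does not distinguish a block from its representative, so as to cover
    both [f] and [h]. *)
Lemma expand_blocks T (g : seq A -> T) acc x : congruence g ->
  (forall u, all (mem B') u -> g (rep (f u, h u)) = g u) ->
  all (mem B') acc -> all (mem B) x ->
  g (expand (blocks acc (x ++ [:: c]))) = g (c :: acc ++ x).
Proof.
move=> cg grep; elim: x acc => [|a x IH] acc Bacc /=.
  by move=> _; rewrite eqxx /expand /= !cats0; apply: (cg [:: c] [:: c]); rewrite ?grep.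
case/andP=> Ba Bx; case: (a =P c) => [->|ac].
  rewrite -[expand _]/((c :: rep _) ++ expand _) -cat_cons.
  apply: (cg); last exact: IH.
  by apply: (cg [:: c] [:: c]); rewrite ?grep.
rewrite IH //; first by rewrite cat_rcons.
by rewrite all_rcons Bacc andbT /= !inE Ba andbT; apply/eqP.
Qed.

Lemma pre_split w x y : pre w = x ++ y ->
  exists w', [/\ w = x ++ w', pre w' = y & c \notin x].
Proof.
elim: x w => [|a x IH] w /=; first by exists w.
case: w => //= b w; case: (b =P c) => // bc [<- /IH[w' [-> ey cx]]].
by exists w'; rewrite inE negb_or cx andbT eq_sym; split=> //; apply/eqP.
Qed.

Lemma pre_catl x y : c \notin x -> pre (x ++ y) = x ++ pre y.
Proof.
elim: x => [|a x IH] //=.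
by rewrite inE negb_or eq_sym => /andP[/negbTE-> /IH->].
Qed.

Lemma first_occurrence w : c \in w -> exists x y, w = x ++ c :: y /\ c \notin x.
Proof.
elim: w => // a w IH; rewrite inE; have [<-|ca] := eqVneq c a.
  by exists [::], w.
by case/IH=> x [y [-> cx]]; exists (a :: x), y; rewrite inE negb_or ca.
Qed.

Lemma last_occurrence w : c \in w -> exists x y, w = x ++ c :: y /\ c \notin y.
Proof.
elim: w => // a w IH; rewrite inE; have [/IH[x [y [-> cy]]] _|cw] := boolP (c \in w).
  by exists (a :: x), y.
by rewrite orbF => /eqP <-; exists [::], w.
Qed.

Lemma starts_tail (P : lang A) w :
  starts c w /\ tail_in P w <-> exists2 y, w = c :: y & P y.
Proof.
split=> [|[y -> Py]] //; case: w => [|a w] [] //.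
by case=> -> [_ Pw]; exists w.
Qed.

(** * Future definability of blocks and of the classes of [f] *)

Local Notation fut := (future (saturated h)).

(** An until that forbids [c] on the way and targets [c] stops at the first [c]. *)
Lemma future_after_first P : fut B P ->
  fut B (fun w => exists x y, [/\ w = x ++ c :: y, c \notin x & P y]).
Proof.
move=> fP; have bF := boolean_future (saturated h) B.
apply: (bool_ext bF (@future_until _ _ _ (fun _ => True) _ _ _
  (bool_not bF (future_starts (saturated h) B c))
  (bool_and bF (future_starts (saturated h) B c) (future_next fP)))) => // w.
split=> [[x [z [-> _ /starts_tail[y -> Py] ncx]]]|[x [y [-> cx Py]]]].
  exists x, y; split=> //; apply/negP => /first_occurrence[x1 [x2 [xE _]]].
  by case: (ncx _ _ xE).
exists x, (c :: y); split=> //.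
move=> x1 [|a x2] // xE _ [ac]; move: cx.
by rewrite xE mem_cat inE ac eqxx orbT.
Qed.

Lemma future_mem : fut B (fun w => c \in w).
Proof.
have bF := boolean_future (saturated h) B.
apply: (bool_ext bF (future_after_first (future_true _ B))) => w.
split=> [[x [y [-> _ _]]]|/first_occurrence[x [y [-> cx]]]].
  by rewrite mem_cat mem_head orbT.
by exists x, y.
Qed.

Lemma future_after_last P : fut B P ->
  fut B (fun w => exists x y, [/\ w = x ++ c :: y, c \notin y & P y]).
Proof.
move=> fP; have bF := boolean_future (saturated h) B.
apply: (bool_ext bF (@future_until _ _ _ (fun _ => True) _ _ _ (future_true _ B)
  (bool_and bF (future_starts (saturated h) B c)
    (future_next (bool_and bF (bool_not bF future_mem) fP))))) => // w.
split=> [[x [z [-> _ /starts_tail[y -> [/negP cy Py]] _]]]|[x [y [-> /negP cy Py]]]].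
  by exists x, y.
by exists x, (c :: y); split=> //; apply/starts_tail; exists y.
Qed.

(** Relativization: letters, next and until are restricted to positions before the first [c]. *)
Lemma future_pre P : fut B' P -> fut B (fun w => P (pre w)).
Proof.
have bF := boolean_future (saturated h) B.
have fc := future_starts (saturated h) B c.
elim=> {P} [|a|P Q _ IHP _ IHQ|P _ IHP|P _ IHP|L P Q CL _ IHP _ IHQ|P P' _ IHP PP'].
- exact: future_true.
- apply: (bool_ext bF (bool_and bF (future_starts _ B a) (bool_const bF (a <> c)))).
  case=> [|b w]; rewrite /starts /=; first by split=> [[]|].
  by case: (b =P c) => [->|bc] /=; [split=> [[[->]]|] | split=> [[]|[<-]]].
- exact: future_or.
- exact: future_not.
- apply: (bool_ext bF (bool_and bF (bool_not bF fc) (future_next IHP))).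
  case=> [|b w]; rewrite /starts /tail_in /=; first by split=> [[_ []]|[]].
  by case: (b =P c) => [->|bc] /=; [split=> [[]|[]] | split=> [[_ []]|[_]] //; split=> // -[]].
- apply: (bool_ext bF (future_until CL (bool_and bF IHP (bool_not bF fc)) IHQ)) => w.
  split=> [[x [y [-> Lx Qy Px]]]|[x [y [/pre_split[w' [-> <- cx]] Lx Qy Px]]]].
    have cx : c \notin x.
      apply/negP => /first_occurrence[x1 [x2 [xE _]]].
      by case: (Px _ _ xE) => // _ [].
    exists x, (pre y); split=> //; first by rewrite pre_catl.
    move=> x1 x2 xE x2n; have [] := Px _ _ xE x2n; rewrite pre_catl //.
    by apply: contra cx; rewrite xE mem_cat orbC => ->.
  exists x, w'; split=> // x1 x2 xE x2n.
  have cx2 : c \notin x2 by apply: contra cx; rewrite xE mem_cat orbC => ->.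
  split; first by rewrite pre_catl //; apply: Px xE x2n.
  case: x2 x2n cx2 {xE} => // a x2 _; rewrite inE => /norP[ca _] [ac].
  by rewrite ac eqxx in ca.
- by apply: future_ext IHP _ => w /all_pre/PP'.
Qed.

Hypothesis IHf : forall m, fut B' (fun w => f w = m).

Lemma blocks_rcons_neq acc x : blocks acc (x ++ [:: c]) <> [::].
Proof. by elim: x acc => [|a x IH] acc /=; [rewrite eqxx|case: eqP]. Qed.

Lemma h_expand_blocks x : all (mem B) x ->
  div_h (blocks [::] (x ++ [:: c])) = h (c :: x).
Proof.
by move=> Bx; apply: (expand_blocks (acc := [::]) ch) => // u /repP[].
Qed.

Lemma f_expand_blocks x : all (mem B) x ->
  f (expand (blocks [::] (x ++ [:: c]))) = f (c :: x).
Proof.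
by move=> Bx; apply: (expand_blocks (acc := [::]) cf) => // u /repP[].
Qed.

(* An until over the word of blocks either stops immediately, or stops at an
   occurrence of [c] and constrains only the occurrences of [c] before it. *)
Lemma blocks_until L P Q w : saturated div_h L -> all (mem B) w ->
  (L [::] /\ Q (blocks [::] w)) \/
  (P (blocks [::] w) /\
   until (fun x => exists2 ts, div_h ts = h (c :: x) & L ts)
     (fun y => ~ (starts c y /\ tail_in (fun y => ~ P (blocks [::] y)) y))
     (fun y => starts c y /\ tail_in (fun y => Q (blocks [::] y)) y) w)
  <-> until L P Q (blocks [::] w).
Proof.
move=> satL Bw; split.
  case=> [[L0 Qw]|[Pw [x [z [wE [ts ets Lts] /starts_tail[y zE Qy] Px]]]]].
    exists [::], (blocks [::] w); split=> // x1 x2.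
    by case: x1 => // ->.
  have Bx : all (mem B) x by move: Bw; rewrite wE all_cat => /andP[].
  exists (blocks [::] (x ++ [:: c])), (blocks [::] y); split=> //.
  - by rewrite wE zE blocks_cat.
  - by apply: satL Lts; rewrite h_expand_blocks.
  - move=> [|t t1] t2; first by move=> /= <- _; rewrite -blocks_cat -zE -wE.
    case/blocks_split=> // x1 [x2 [xE _ <-]].
    case/lastP: x2 xE => // x2 a.
    rewrite cats1 -rcons_cons -rcons_cat => /rcons_inj[xE <-] _.
    rewrite -cats1 -blocks_cat -zE; apply: contrapT => nP.
    by case: (Px _ _ xE) => //; apply/starts_tail; exists (x2 ++ z).
case=> ts [ts' [wE Lts Qts' Pts]].
have [ts0|tsn] := pselect (ts = [::]).
  by left; rewrite wE ts0 -{1}ts0.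
have [x [y [wxy xE yE]]] := blocks_split wE tsn.
have Bx : all (mem B) x by move: Bw; rewrite wxy all_cat => /andP[].
right; split; first by rewrite wE; apply: (Pts [::]).
exists x, (c :: y); split=> //.
- by exists ts; rewrite // -xE h_expand_blocks.
- by apply/starts_tail; exists y; rewrite ?yE.
- move=> x1 [|a x2] // x12 _ /starts_tail[_ [ac <-]]; apply; rewrite ac in x12.
  rewrite blocks_cat yE; apply: (Pts (blocks [::] (x1 ++ [:: c]))).
    by rewrite -xE x12 -catA cat_cons blocks_cat.
  exact: blocks_rcons_neq.
Qed.

(** A letter of the word of blocks is tested by the classes of [pre w], when [c] occurs; next jumps
    past the first [c]; until is [blocks_until]. *)
Lemma future_blocks K : future (saturated div_h) [set: M * N] K ->
  fut B (fun w => K (blocks [::] w)).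
Proof.
have bF := boolean_future (saturated h) B.
have fc := future_starts (saturated h) B c.
elim=> {K} [|[m n]|P Q _ IHP _ IHQ|P _ IHP|P _ IHP|L P Q CL _ IHP _ IHQ|P P' _ IHP PP'].
- exact: future_true.
- have fn : fut B' (fun w => h w = n) by apply: future_base => x y ->.
  apply: (bool_ext bF (bool_and bF future_mem
    (bool_and bF (future_pre (IHf m)) (future_pre fn)))) => w.
  have [/first_occurrence[x [y [-> cx]]]|cw] := boolP (c \in w).
    by rewrite /starts blocks_first ?pre_cat //=; split=> [[_ [-> ->]]|[-> ->]].
  by rewrite /starts blocks_nil //; split=> [[]|].
- exact: future_or.
- exact: future_not.
- apply: (bool_ext bF (future_after_first IHP)) => w; rewrite /tail_in.
  split=> [[x [y [-> cx Py]]]|[]]; first by rewrite blocks_first.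
  have [/first_occurrence[x [y [-> cx]]]|cw] := boolP (c \in w).
    by rewrite blocks_first //= => _ Py; exists x, y.
  by rewrite blocks_nil.
- pose L' x := exists2 ts, div_h ts = h (c :: x) & L ts.
  have CL' : saturated h L'.
    move=> x y exy [ts ets Lts]; exists ts; rewrite // ets.
    exact: (ch (erefl (h [:: c])) exy).
  have fP := bool_not bF (bool_and bF fc (future_next (bool_not bF IHP))).
  have fQ := bool_and bF fc (future_next IHQ).
  apply: (future_ext (bool_or bF (bool_and bF (bool_const bF (L [::])) IHQ)
    (bool_and bF IHP (future_until CL' fP fQ)))) => w Bw.
  exact: blocks_until.
- by apply: (bool_ext bF IHP) => w; apply: PP'; apply/allP => a; rewrite !inE.
Qed.

(** Between the first and the last [c], blocks are replaced by their representatives. The closing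
    [[:: c]] is the last [c], which is also the first when [y] has no complete block. *)
Lemma f_decompose w x y x' y' : all (mem B) w ->
  w = x ++ c :: y -> c \notin x -> w = x' ++ c :: y' -> c \notin y' ->
  f w = f (x ++ (expand (blocks [::] y) ++ [:: c]) ++ y').
Proof.
move=> Bw wE cx wE' cy'; have := wE'; rewrite {1}wE => /cat_eq_cat[].
  case=> -[|a z] [x'E /=]; first by case=> yE; rewrite wE yE blocks_nil.
  case=> _ yE; have Bz : all (mem B) z.
    by move: Bw; rewrite wE yE all_cat /= all_cat => /and3P[_ _ /andP[]].
  rewrite wE yE blocks_cat (blocks_nil _ cy') cats0 -catA.
  apply: cf => //; rewrite -[c :: z ++ _]cat_cons.
  by apply: cf => //; rewrite f_expand_blocks.
case=> -[|a z] [xE /=]; first by case=> yE; rewrite wE -yE blocks_nil.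
by case=> cE _; move: cx; rewrite xE -cE mem_cat mem_head orbT.
Qed.

Hypothesis IHdiv :
  forall s, future (saturated div_h) [set: M * N] (fun ts => div_f ts = s).

Lemma future_local_divisor m : fut B (fun w => f w = m).
Proof.
have bF := boolean_future (saturated h) B.
pose F1 s w := exists x y, [/\ w = x ++ c :: y, c \notin x & div_f (blocks [::] y) = s].
(* Here [pre y] is [y]; writing it so lets [future_pre] lift the hypothesis on [c]-free words. *)
pose F2 m1 w := exists x y, [/\ w = x ++ c :: y, c \notin y & f (pre y) = m1].
pose F (p : M * M * M) w := [/\ f (pre w) = p.1.1, F1 p.1.2 w & F2 p.2 w].
have fF p : fut B (F p).
  apply: (bool_ext bF (bool_and bF (future_pre (IHf p.1.1)) (bool_and bF
    (future_after_first (future_blocks (IHdiv p.1.2)))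
    (future_after_last (future_pre (IHf p.2)))))) => w.
  by split=> [[? []]|[]].
have Fdet p w w' : all (mem B) w -> all (mem B) w' -> F p w -> F p w' -> f w = f w'.
  move=> Bw Bw' [e0 [x [y [wE cx e1]]] [x' [y' [wE' cy' e2]]]].
  case=> d0 [u [v [wu cu d1]]] [u' [v' [wu' cv' d2]]].
  rewrite (f_decompose Bw wE cx wE' cy') (f_decompose Bw' wu cu wu' cv').
  move: e0 d0; rewrite wE wu !pre_cat // => e0 d0.
  move: e2 d2; rewrite !pre_id // => e2 d2.
  apply: cf; first by rewrite e0.
  by apply: cf; [exact: etrans e1 (esym d1)|rewrite e2].
(* Words without [c] are their own prefix [pre w]. On the others [F p] determines [f], so the fiber
   is the union of the finitely many [F p] that meet it. *)
apply: (future_ext (bool_or bF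
  (bool_and bF (bool_not bF future_mem) (future_pre (IHf m)))
  (bool_exists bF (fun p => bool_and bF (fF p)
    (bool_const bF (exists w', [/\ all (mem B) w', F p w' & f w' = m])))))) => w Bw.
split.
  case=> [[/negP cw <-]|[p [Fw [w' [Bw' Fw' <-]]]]]; first by rewrite pre_id.
  exact: Fdet Fw Fw'.
move=> fw; have [cw|cw] := boolP (c \in w); last first.
  by left; rewrite pre_id //; split=> //; apply/negP.
right.
have [x [y [wE cx]]] := first_occurrence cw.
have [x' [y' [wE' cy']]] := last_occurrence cw.
have Fw : F (f (pre w), div_f (blocks [::] y), f (pre y')) w.
  by split=> //; [exists x, y|exists x', y'].
by eexists; split; [exact: Fw|exists w].
Qed.

End LocalDivisor.

(** * The double induction and the equality of the three classes *)

Lemma future_aperiodic (A M N : finType) (f : seq A -> M) (h : seq A -> N)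
    (B : {set A}) m :
  congruence f -> congruence h -> aperiodic_over f h ->
  future (saturated h) B (fun w => f w = m).
Proof.
(* The outer induction, on the number of values of [f], generalizes over the alphabet because
   [div_f] reads words over pairs of classes; the inner one is on the size of [B]. *)
have [n] := ubnP #|[set m | `[< exists w, f w = m >]]|.
elim: n A M N f h B m => // n IHn A M N f h B m; rewrite ltnS => len cf ch afh.
have [k] := ubnP #|B|; elim: k B m => // k IHk B m; rewrite ltnS => leB.
have [inv|] := pselect (forall b, b \in B -> exists y, f (rcons y b) = f [::]).
  exact: future_invertible.
move=> /existsNP[c /not_implyP[cB /forallNP nc]].
apply: (future_local_divisor (c := c)) => // [m'|s].
  by apply: IHk; rewrite (leq_trans _ leB) // [X in _ < X](cardsD1 c) cB.
apply: IHn.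
- by apply: leq_trans len; apply: card_div.
- exact: congruence_div_f.
- exact: congruence_div_h.
- exact: aperiodic_div.
Qed.

Lemma SF_LTL (A : finType) (C : lang A -> Prop) L : prevariety C -> SF C L -> LTL C L.
Proof.
move=> pvC /(SF_recognizer pvC)[M [N [f [h [[cf ch Ch _ afh] fL]]]]].
apply: (future_LTL pvC).
apply: (fibers_determine (boolean_future C [set: A]) _ fL) => m.
(* An [h]-saturated language is a finite union of fibers of [h], hence lies in [C]. *)
apply: (future_sub (C := saturated h)); last exact: future_aperiodic.
by move=> L' satL'; apply: (fibers_determine (boolean_prevariety pvC) Ch).
Qed.

Theorem theorem7p4 (A : finType) (C : lang A -> Prop) :
  prevariety C ->
  (forall L, SF C L <-> LTL C L) /\ (forall L, LTL C L <-> LTLP C L).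
Proof.
move=> pvC.
have LTL_LTLP L : LTL C L -> LTLP C L by case=> phi [Cphi _ dphi]; exists phi.
split=> L; split.
- exact: SF_LTL.
- by move/LTL_LTLP; apply: LTLP_SF.
- exact: LTL_LTLP.
- by move/(LTLP_SF pvC); apply: SF_LTL.
Qed.
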